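(* Let $(V,Y,\mathbf 1,\omega)$ be a vertex operator algebra with $V_{(0)}=\mathbb{C}\mathbf 1$ and $V_{(n)}=0$ for $n<0$, and let $u\in V_{(1)}$ satisfy $L(1)u=0$. Then for every $t\in\mathbb{C}$ the operator $e^{tY_0(u)}$ is an automorphism of the vertex operator algebra $V$.
   Context: $V=\coprod_{n\in\mathbb{Z}}V_{(n)}$ has finite-dimensional homogeneous subspaces, $Y(v,x)=\sum_{n\in\mathbb{Z}}Y_n(v)x^{-n-1}$, and $L(n)=Y_{n+1}(\omega)$. The operator $Y_0(u)=\mathrm{Res}_xY(u,x)$ preserves each finite-dimensional space $V_{(n)}$, so $e^{tY_0(u)}$ is well defined on $V$. An automorphism of $V$ is a grading-preserving linear bijection $h$ with $hY(v,x)=Y(hv,x)h$ for $v\in V$, $h\mathbf 1=\mathbf 1$ and $h\omega=\omega$. *)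

(* Defs.v *)
From HB Require Import structures.
From mathcomp Require Import all_boot all_order all_algebra.
From mathcomp Require Import complex.
From mathcomp Require Import all_classical all_reals all_analysis.

Set Implicit Arguments.
Unset Strict Implicit.
Unset Printing Implicit Defensive.

Import Order.TTheory GRing.Theory Num.Theory.
Import numFieldNormedType.Exports.

Local Open Scope classical_set_scope.
Local Open Scope ring_scope.
Local Open Scope complex_scope.

(* Binomial coefficient with integer upper entry, m(m-1)...(m-i+1)/i!. *)
Definition binz (F : fieldType) (m : int) (i : nat) : F :=
  (\prod_(j < i) (m%:~R - j%:R)) / (i`!)%:R.

Section LinearAlgebra.
Variables (R : realType) (V : lmodType R[i]).

Definition fin_dim (W : set V) : Prop :=
  exists (d : nat) (e : 'I_d -> V),
    W = [set \sum_(i < d) c i *: e i | c in [set: 'I_d -> R[i]]].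

(* V is the (internal) direct sum of the family of subspaces G. *)
Definition direct_sum (G : int -> set V) : Prop :=
  forall v : V, exists! w : int -> V,
    [/\ forall n, G n (w n),
        finite_set [set n | w n != 0]
      & v = \sum_(n \in [set: int]) w n].

(* Convergence inside some finite-dimensional subspace of V, each such
   subspace having its canonical topology, i.e. the one transported from C^d
   by a linear isomorphism phi. *)
Definition fd_cvg (w : nat -> V) (l : V) : Prop :=
  exists (d : nat) (phi : {linear 'rV[R[i]^o]_d -> V})
         (x : nat -> 'rV[R[i]^o]_d) (y : 'rV[R[i]^o]_d),
    [/\ injective phi,
        forall k, w k = phi (x k),
        l = phi y
      & x @ \oo --> y].

(* e^A v = \sum_k A^k v / k!, for an operator A such that the A^k v span a
   finite-dimensional space (e.g. A preserves each finite-dimensional summand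
   of a direct sum decomposition of V). Where the series does not converge the
   value is 0. *)
Definition op_exp (A : V -> V) (v : V) : V :=
  xget 0 [set l | fd_cvg
    (fun N => \sum_(k < N) ((k`!)%:R : R[i])^-1 *: iter k A v) l].

End LinearAlgebra.

(* [Y n v] is the mode Y_n(v) of Y(v,x) = \sum_n Y_n(v) x^(-n-1).
   All the sums \sum_(i \in [set: nat]) below have finite support, by
   [voa_truncation]. *)
Record voa (R : realType) := VOA {
  voa_sort :> lmodType R[i];
  voa_gr : int -> set voa_sort;
  voa_Y : int -> voa_sort -> voa_sort -> voa_sort;
  voa_vac : voa_sort;
  voa_omega : voa_sort;
  voa_gr_fin_dim : forall n, fin_dim (voa_gr n);
  voa_gr_sum : direct_sum voa_gr;
  voa_gr_bounded : exists N : int, forall n, n < N -> voa_gr n = [set 0];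
  voa_Y_linear : forall n v, linear (voa_Y n v);
  voa_Y_linearl : forall n w, linear (fun v => voa_Y n v w);
  voa_truncation : forall v w, exists N : int,
    forall n, N <= n -> voa_Y n v w = 0;
  voa_vac_gr : voa_gr 0 voa_vac;
  voa_omega_gr : voa_gr 2 voa_omega;
  voa_vacuum : forall n v,
    voa_Y n voa_vac v = if n == - 1 then v else 0;
  voa_creation : forall n v, 0 <= n -> voa_Y n v voa_vac = 0;
  voa_creation_lim : forall v, voa_Y (- 1) v voa_vac = v;
  (* The coefficient of x0^(-l-1) x1^(-m-1) x2^(-n-1) in the Jacobi identity
       x0^-1 delta((x1-x2)/x0) Y(u,x1) Y(v,x2)
         - x0^-1 delta((x2-x1)/(-x0)) Y(v,x2) Y(u,x1)
       = x2^-1 delta((x1-x0)/x2) Y(Y(u,x0)v,x2),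
     binomials being expanded in nonnegative powers of the second variable. *)
  voa_jacobi : forall (l m n : int) (u v w : voa_sort),
    \sum_(i \in [set: nat])
       ((-1) ^+ i * binz R[i] l i) *:
         voa_Y (m + l - i%:Z) u (voa_Y (n + i%:Z) v w)
    - \sum_(i \in [set: nat])
       ((-1) ^ l * (-1) ^+ i * binz R[i] l i) *:
         voa_Y (n + l - i%:Z) v (voa_Y (m + i%:Z) u w)
    = \sum_(i \in [set: nat])
       binz R[i] m i *: voa_Y (m + n - i%:Z) (voa_Y (l + i%:Z) u v) w;
  voa_virasoro : exists c : R[i], forall (m n : int) (v : voa_sort),
    let L k := voa_Y (k + 1) voa_omega in
    L m (L n v) - L n (L m v) =
      (m - n)%:~R *: L (m + n) v +
      (if m + n == 0 then ((m ^+ 3 - m)%:~R / 12%:R * c) *: v else 0);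
  voa_L0 : forall n v, voa_gr n v -> voa_Y (0 + 1) voa_omega v = n%:~R *: v;
  (* d/dx Y(v,x) = Y(L(-1)v,x) *)
  voa_Lm1 : forall n v w,
    voa_Y n (voa_Y (- 1 + 1) voa_omega v) w = (- n)%:~R *: voa_Y (n - 1) v w
}.

Arguments voa_gr {R} V n _ : rename.

Definition voa_L (R : realType) (V : voa R) (n : int) : V -> V :=
  voa_Y (n + 1) (voa_omega V).

Definition voa_automorphism (R : realType) (V : voa R) (h : V -> V) : Prop :=
  [/\ linear h /\ bijective h,
      forall n v, voa_gr V n v -> voa_gr V n (h v),
      forall n v w, h (voa_Y n v w) = voa_Y n (h v) (h w),
      h (voa_vac V) = voa_vac V
    & h (voa_omega V) = voa_omega V].

(* Main.v *)
(** The zero mode D = Y_0(u) commutes with L(0), so it preserves each weight space,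
    and the Jacobi identity makes it a derivation of all products v, w |-> Y_n(v)w.
    Hence e^(tD) exists on each finite-dimensional D-stable subspace, and by the Cauchy
    product of exponential series it is an automorphism of these products, with inverse
    e^(-tD). It fixes the vacuum because D kills it, and it fixes omega = L(-2)1 because
    [L(-2), D] only involves L(k)u with k >= -1, where L(1)u = 0 by assumption,
    L(k)u = 0 for k > 1 by weight, and the contributions of L(-1)u and L(0)u cancel. *)
From HB Require Import structures.
Require Import Defs.
From mathcomp Require Import all_boot all_order all_algebra.
From mathcomp Require Import finmap complex.
From mathcomp Require Import all_classical all_reals all_analysis.
Import Order.TTheory GRing.Theory Num.Theory.
Import numFieldNormedType.Exports.
Local Open Scope classical_set_scope.
Local Open Scope ring_scope.
Local Open Scope complex_scope.
Set Implicit Arguments.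
Unset Strict Implicit.
Unset Printing Implicit Defensive.

(** * Leibniz rule for truncated exponential series *)

Lemma sum_triangle (Z : nmodType) (F : nat -> nat -> Z) N :
  \sum_(0 <= k < N) \sum_(0 <= i < k.+1) F i (k - i)%N =
  \sum_(0 <= i < N) \sum_(0 <= j < N - i) F i j.
Proof.
elim: N => [|N IH]; first by rewrite !big_geq.
rewrite big_nat_recr //= IH [RHS]big_nat_recr //= subSnn big_nat1.
rewrite big_nat_recr //= subnn addrA; congr (_ + _).
rewrite -big_split; apply: eq_big_nat => i /andP[_ iN] /=.
by rewrite subSn ?big_nat_recr // ltnW.
Qed.

(** Over [R[i]] these are the partial sums in [op_exp]; a general field lets the same lemmas serve
    the real exponential. *)
Definition exp_sum (F : numFieldType) (U : lmodType F) (A : U -> U) (v : U) N : U :=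
  \sum_(k < N) (k`!%:R : F)^-1 *: iter k A v.

Section BilinearLeibniz.
Variables (F : numFieldType) (U W Z : lmodType F) (b : {bilinear U -> W -> Z}).
Variables (A : U -> U) (B : W -> W) (C : {linear Z -> Z}).
Hypothesis bC : forall u w, C (b u w) = b (A u) w + b u (B w).

Lemma iter_Leibniz k u w :
  iter k C (b u w) =
  \sum_(0 <= i < k.+1) b (iter i A u) (iter (k - i) B w) *+ 'C(k, i).
Proof.
elim: k => [|k IH] /=; first by rewrite big_nat1.
rewrite IH linear_sum.
rewrite (eq_big_nat _ _ (F2 := fun i =>
   b (iter i.+1 A u) (iter (k - i) B w) *+ 'C(k, i) +
   b (iter i A u) (iter (k.+1 - i) B w) *+ 'C(k, i))); last first.
  by move=> i /andP[_ ik]; rewrite raddfMn /= bC mulrnDl subSn.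
rewrite big_split /= [RHS]big_nat_recl //= bin0.
under [in RHS]eq_big_nat => i _ do rewrite binS mulrnDr subSS.
rewrite !big_split /= addrA [LHS]addrC; congr (_ + _).
rewrite [X in _ = _ + X]big_nat_recr //= bin_small // mulr0n addr0.
by rewrite big_nat_recl //= bin0.
Qed.

(** The index square i, j < N is cut along i + j = N. The part i + j < N sums to the truncated
    series of [C] by the binomial Leibniz rule; the other corner is the error term. *)
Lemma exp_sum_Leibniz N u w :
  b (exp_sum A u N) (exp_sum B w N) = exp_sum C (b u w) N +
  \sum_(0 <= i < N) \sum_(N - i <= j < N)
    ((i`!%:R : F)^-1 * (j`!%:R)^-1) *: b (iter i A u) (iter j B w).
Proof.
pose G i j := ((i`!%:R : F)^-1 * (j`!%:R)^-1) *: b (iter i A u) (iter j B w).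
transitivity (\sum_(0 <= i < N) \sum_(0 <= j < N) G i j).
  rewrite linear_sumlz big_mkord /=; apply: eq_bigr => i _.
  rewrite linear_sumr big_mkord /=; apply: eq_bigr => j _.
  by rewrite linearZl_LR linearZr_LR /= scalerA.
under eq_big_nat => i _ do rewrite (@big_cat_nat _ _ _ (N - i)) ?leq_subr //=.
rewrite big_split /= -(sum_triangle G); congr (_ + _).
rewrite big_mkord; apply: eq_bigr => k _.
rewrite iter_Leibniz scaler_sumr; apply: eq_big_nat => i /andP[_ ik].
rewrite /G -[b _ _ *+ _]scaler_nat scalerA; congr (_ *: _).
have h m : (m`!%:R : F) != 0 by rewrite pnatr_eq0 -lt0n fact_gt0.
rewrite -(bin_fact (_ : i <= k)%N) // !natrM !invfM.
by rewrite mulrAC mulVf ?mul1r // pnatr_eq0 -lt0n bin_gt0.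
Qed.

End BilinearLeibniz.

(** Packaged as a bilinear map so that the Leibniz rule covers scalar exponentials. *)
Definition regular_mul (F : numFieldType) (x y : F^o) : F^o := x * y.

Fact regular_mul_bilinear (F : numFieldType) :
  bilinear_for *:%R *:%R (@regular_mul F).
Proof.
split=> z a x y; rewrite /regular_mul /= ?mulrDl ?mulrDr; congr (_ + _).
  by rewrite -[LHS]mulrA.
by rewrite [LHS]mulrCA.
Qed.

HB.instance Definition _ (F : numFieldType) :=
  bilinear_isBilinear.Build F F^o F^o F^o *:%R *:%R (@regular_mul F)
    (regular_mul_bilinear F).

(** * Convergence of complex exponential series *)

Section ComplexSeries.
Variable R : realType.
Local Notation C := (R[i]^o).
Local Notation re := complex.Re.
Local Notation im := complex.Im.

Lemma cvg_complex (z : nat -> R[i]) (l : R[i]) :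
  (fun n => re (z n)) @ \oo --> re l -> (fun n => im (z n)) @ \oo --> im l ->
  (z : nat -> C) @ \oo --> (l : C).
Proof.
move=> /cvgrPdist_lt hr /cvgrPdist_lt hi; apply/cvgrPdist_lt => e.
(* Positive elements of [R[i]] are real, so epsilon becomes a real number. *)
case: e => e e'; rewrite ltcE /= => /andP[/eqP -> e0].
have e20 : 0 < e / 2 by rewrite divr_gt0.
near=> n.
have nr (x : R) : `|x%:C| = (`|x|%:C : R[i]).
  by rewrite normc_def /= expr0n addr0 sqrtr_sqr.
have ni : `|'i%C| = 1 :> R[i] by rewrite normc_def /= expr0n add0r expr1n sqrtr1.
have -> : (l : C) - z n = ((re l - re (z n))%:C + 'i%C * (im l - im (z n))%:C : R[i]).
  by rewrite {1}[l]complexE {1}[z n]complexE !rmorphB /= mulrBr opprD addrACA.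
have : `|re l - re (z n)|%:C + `|im l - im (z n)|%:C < (e%:C : R[i]).
  by rewrite -rmorphD ltcR [ltRHS]splitr ltrD //; near: n; [exact: hr|exact: hi].
apply: le_lt_trans; rewrite (le_trans (ler_normD _ _)) // normrM !nr.
by rewrite ni mul1r.
Unshelve. all: by end_near. Qed.

Lemma normc_ge_Re_Im (z : R[i]) (c : R) : `|z| <= c%:C -> `|re z| <= c /\ `|im z| <= c.
Proof.
rewrite normc_def lecR => h; split; apply: le_trans h; rewrite -sqrtr_sqr ler_wsqrtr //.
  by rewrite lerDl sqr_ge0.
by rewrite lerDr sqr_ge0.
Qed.

Lemma is_cvg_exp_dominated (f : nat -> R) (c b : R) : 0 <= b ->
  (forall k, `|f k| <= c * b ^+ k) -> cvgn (fun N => \sum_(k < N) (k`!%:R)^-1 * f k).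
Proof.
move=> b0 fb.
rewrite (_ : (fun N : nat => _) = series (fun k => (k`!%:R)^-1 * f k)); last first.
  by apply/funext => N; rewrite /series /= big_mkord.
apply: normed_cvg.
apply: (@series_le_cvg _ _ (fun n => c * exp_coeff b n)) => [n|n|n|].
- exact: normr_ge0.
- by rewrite /exp_coeff /= mulrA divr_ge0 // (le_trans _ (fb n)).
- rewrite /= normrM /exp_coeff /= mulrA [leLHS]mulrC normfV normr_nat.
  by rewrite ler_wpM2r // invr_ge0.
- by apply: (@is_cvg_seriesZ _ (exp_coeff b) c); exact: is_cvg_series_exp_coeff.
Qed.

Lemma is_cvg_expC_dominated (z : nat -> R[i]) (c b : R) : 0 <= b ->
  (forall k, `|z k| <= (c * b ^+ k)%:C) ->
  exists l : C, (fun N => \sum_(k < N) (k`!%:R)^-1 * z k : C) @ \oo --> l.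
Proof.
move=> b0 zb.
have hr := is_cvg_exp_dominated b0 (fun k => (normc_ge_Re_Im (zb k)).1).
have hi := is_cvg_exp_dominated b0 (fun k => (normc_ge_Re_Im (zb k)).2).
exists ((lim ((fun N => \sum_(k < N) (k`!%:R)^-1 * re (z k)) @ \oo)) +i*
        (lim ((fun N => \sum_(k < N) (k`!%:R)^-1 * im (z k)) @ \oo))).
have fc k : (k`!%:R)^-1 = ((k`!%:R : R)^-1)%:C :> R[i] by rewrite fmorphV rmorph_nat.
apply: cvg_complex => /=.
  rewrite (_ : (fun _ => _) = (fun N => \sum_(k < N) (k`!%:R)^-1 * re (z k))) //.
  apply/funext => N; elim/big_rec2 : _ => //= i x y _ <-.
  by rewrite fc; case: y (z i) => [? ?] [? ?] /=; rewrite mul0r subr0.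
rewrite (_ : (fun _ => _) = (fun N => \sum_(k < N) (k`!%:R)^-1 * im (z k))) //.
apply/funext => N; elim/big_rec2 : _ => //= i x y _ <-.
by rewrite fc; case: y (z i) => [? ?] [? ?] /=; rewrite mul0r addr0.
Qed.

(* The tail is the Cauchy product defect e_N(b)^2 - e_N(2b) of the partial sums
   of the exponential, hence tends to exp(b)^2 - exp(2b) = 0. *)
Lemma cvg_exp_tail_pow (b : R) :
  (fun N => \sum_(0 <= i < N) \sum_(N - i <= j < N)
    ((i`!%:R : R)^-1 * (j`!%:R)^-1) * b ^+ (i + j)) @ \oo --> (0 : R).
Proof.
(* Iterating multiplication by a on 1 gives the powers of a. *)
have e (a : R) : (fun N => exp_sum ( *:%R a : R^o -> R^o) 1 N) @ \oo --> expR a.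
  rewrite (_ : (fun _ => _) = series (exp_coeff a)).
    exact: is_cvg_series_exp_coeff.
  apply/funext => N; rewrite /series /= big_mkord; apply: eq_bigr => k _.
  by rewrite (iter_mulr k a) mulr1 [_ *: _]mulrC.
suff -> : (fun N => \sum_(0 <= i < N) \sum_(N - i <= j < N)
    ((i`!%:R : R)^-1 * (j`!%:R)^-1) * b ^+ (i + j)) =
  (fun N => exp_sum ( *:%R b : R^o -> R^o) 1 N * exp_sum ( *:%R b : R^o -> R^o) 1 N
    - exp_sum ( *:%R (b + b) : R^o -> R^o) 1 N : R).
  rewrite -[0](subrr (expR b * expR b)) -[X in _ - X]expRD.
  exact: (cvgB (cvgM (e b) (e b)) (e (b + b))).
apply/funext => N.
have Leib (u w : R^o) :
    (b + b) *: regular_mul u w = regular_mul (b *: u) w + regular_mul u (b *: w).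
  by rewrite /regular_mul [LHS]mulrDl; congr (_ + _); [exact: mulrA|exact: mulrCA].
have := exp_sum_Leibniz (C := *:%R (b + b) : {linear R^o -> R^o}) Leib N 1 1.
rewrite /= (mulr1 1 : regular_mul 1 1 = 1 :> R^o) /regular_mul => ->.
rewrite addrC addKr; apply: eq_bigr => i _; apply: eq_bigr => j _.
by rewrite !(iter_mulr _ b) !mulr1 exprD.
Qed.

(** The norm is at most c times the real tail of [cvg_exp_tail_pow], which tends to 0. *)
Lemma cvg_exp_tail (z : nat -> nat -> R[i]) (c b : R) :
  (forall i j, `|z i j| <= (c * b ^+ (i + j))%:C) ->
  (fun N => \sum_(0 <= i < N) \sum_(N - i <= j < N)
    ((i`!%:R)^-1 * (j`!%:R)^-1) * z i j : C) @ \oo --> (0 : C).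
Proof.
move=> zb.
have nf k : `|(k`!%:R : R[i])^-1| = ((k`!%:R : R)^-1)%:C.
  by rewrite normfV normr_nat fmorphV rmorph_nat.
have /cvgrPdist_lt tail0 : (fun N => c * \sum_(0 <= i < N) \sum_(N - i <= j < N)
    ((i`!%:R : R)^-1 * (j`!%:R)^-1) * b ^+ (i + j)) @ \oo --> (0 : R).
  by have := cvgM (cvg_cst c) (@cvg_exp_tail_pow b); rewrite mulr0 => h; exact: h.
apply/cvgrPdist_lt => e.
case: e => e e'; rewrite ltcE /= => /andP[/eqP -> e0].
near=> N.
have : `|0 - c * \sum_(0 <= i < N) \sum_(N - i <= j < N)
    ((i`!%:R : R)^-1 * (j`!%:R)^-1) * b ^+ (i + j)| < e by near: N; exact: tail0.
rewrite !sub0r !normrN => h.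
have {h} := le_lt_trans (ler_norm _) h; rewrite -ltcR; apply: le_lt_trans.
rewrite mulr_sumr rmorph_sum /= (le_trans (ler_norm_sum _ _ _)) //.
apply: ler_sum => i _.
rewrite mulr_sumr rmorph_sum /= (le_trans (ler_norm_sum _ _ _)) //.
apply: ler_sum => j _.
by rewrite !normrM !nf mulrCA 2!rmorphM /= ler_wpM2l // mulr_ge0 // ler0c invr_ge0.
Unshelve. all: by end_near. Qed.

End ComplexSeries.

(** * Matrices: entrywise convergence and quotient by a kernel *)

Section Coordinates.
Variables (R : realType).
Local Notation K := (R[i]^o).

Lemma cvg_mx m n (x : nat -> 'M[K]_(m, n)) (y : 'M[K]_(m, n)) :
  (forall i j, (fun k => x k i j) @ \oo --> y i j) <-> x @ \oo --> y.
Proof.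
split=> [h|h i j]; last first.
  by apply: (continuous_cvg _ (@coord_continuous _ _ _ i j y)).
apply/cvg_ballP => e e0.
have : \forall k \near \oo, forall i j, ball (y i j) e (x k i j).
  apply: filter_forall => i; apply: filter_forall => j.
  by move/cvg_ballP : (h i j); exact.
by apply: filterS => k hk; split.
Qed.

Lemma cvg_mulmx m n p (x : nat -> 'M[K]_(m, n)) (x' : nat -> 'M[K]_(n, p))
  (y : 'M[K]_(m, n)) (y' : 'M[K]_(n, p)) :
  x @ \oo --> y -> x' @ \oo --> y' -> (fun k => x k *m x' k) @ \oo --> y *m y'.
Proof.
move=> /cvg_mx hx /cvg_mx hx'; apply/cvg_mx => i j; rewrite mxE.
under eq_fun do rewrite mxE.
have ac : continuous (fun z : K * K => z.1 + z.2).
  by move=> z; exact: (@add_continuous K z).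
by apply: (@cvg_big K 'I_n _ _ xpredT ac) => l _; exact: cvgM.
Qed.

(* [P] and [Q] identify the quotient of ['rV_d] by the kernel of [psi] with ['rV_r]. *)
Lemma kernel_projection (V : lmodType R[i]) d (psi : {linear 'rV[K]_d -> V}) :
  exists r (P : 'M[K]_(d, r)) (Q : 'M[K]_(r, d)),
    [/\ Q *m P = 1%:M, forall z, psi (z *m P *m Q) = psi z
      & forall z, psi z = 0 -> z *m P = 0].
Proof.
(* The kernel is found as the row space of a matrix of maximal rank among those whose rows [psi]
   kills. *)
pose ker_rank n :=
  `[< exists B : 'M[K]_d, (forall z, psi (z *m B) = 0) /\ \rank B = n >].
have ex : exists n, ker_rank n.
  exists 0%N; apply/asboolP; exists 0; split; last exact: mxrank0.
  by move=> z; rewrite mulmx0 linear0.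
have ub n : ker_rank n -> (n <= d)%N by move=> /asboolP[B [_ <-]]; exact: rank_leq_row.
case: (ex_maxnP ex ub) => r /asboolP[B [Bker rB]] rmax.
(* Adjoining a kernel vector to [B] cannot raise the maximal rank, so it already lies in the row
   space. *)
have kerB z : psi z = 0 -> (z <= B)%MS.
  move=> z0; apply: (submx_trans (addsmxSr B z)).
  rewrite -(geq_leqif (mxrank_leqif_sup (addsmxSl B z))) rB; apply: rmax.
  apply/asboolP; exists (B + z)%MS; split=> // w.
  have /sub_addsmxP[[a b] /= ->] := submxMl w (B + z)%MS.
  by rewrite linearD Bker add0r [b]mx11_scalar mul_scalar_mx linearZ /= z0 scaler0.
(* P is a column basis of [cokermx B]: the z with z P = 0 form the row space of [B], and Q is a left
   inverse of P. *)
have /row_fullP[Q QP] := col_base_full (cokermx B).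
exists (\rank (cokermx B)), (col_base (cokermx B)), Q.
have inker z : z *m col_base (cokermx B) = 0 <-> (z <= B)%MS.
  split=> [z0|zB].
    by rewrite submxE -(mulmx_base (cokermx B)) mulmxA z0 mul0mx.
  apply: (row_free_inj (row_base_free (cokermx B))).
  by rewrite mul0mx -mulmxA mulmx_base; apply/eqP; rewrite -submxE.
split=> // z; last by move=> /kerB/inker.
apply/eqP; rewrite -subr_eq0 -linearB; apply/eqP.
have /inker/submxP[w ->] :
    (z *m col_base (cokermx B) *m Q - z) *m col_base (cokermx B) = 0.
  by rewrite mulmxBl -!mulmxA QP mulmx1 subrr.
exact: Bker.
Qed.

End Coordinates.

(** * Convergence in finite-dimensional subspaces *)

Section FiniteDimensionalConvergence.
Variables (R : realType).
Local Notation K := (R[i]^o).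

(* The parametrisation [psi] need not be injective: its kernel can be quotiented out. *)
Lemma fd_cvg_image (V : lmodType R[i]) d (psi : {linear 'rV[K]_d -> V})
    (x : nat -> 'rV[K]_d) (y : 'rV[K]_d) :
  x @ \oo --> y -> fd_cvg (psi \o x) (psi y).
Proof.
move=> xy; have [r [P [Q [QP psiPQ kerP]]]] := kernel_projection psi.
exists r, (psi \o mulmxr Q), (fun k => x k *m P), (y *m P); split=> //=.
- by apply/raddf_inj => z /= /kerP; rewrite -mulmxA QP mulmx1.
- by move=> k; rewrite psiPQ.
- by rewrite psiPQ.
- by apply: cvg_mulmx xy _; exact: cvg_cst.
Qed.

Lemma mxvec_tensorE d d' (s : 'rV[K]_d) (t : 'rV[K]_d') i j :
  mxvec (s^T *m t) 0 (mxvec_index i j) = s 0 i * t 0 j.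
Proof. by rewrite mxvecE mxE big_ord1 mxE. Qed.

(** Factorisation through the tensor product, realised by the outer product s^T t; limits under [b]
    become limits under a linear map. *)
Lemma bilinear_tensor (U W Z : lmodType R[i]) (b : {bilinear U -> W -> Z}) d d'
    (phi : {linear 'rV[K]_d -> U}) (phi' : {linear 'rV[K]_d' -> W}) :
  exists Psi : {linear 'rV[K]_(d * d') -> Z},
    forall s t, b (phi s) (phi' t) = Psi (mxvec (s^T *m t)).
Proof.
pose Psi (z : 'rV[K]_(d * d')) := \sum_i \sum_j
  (vec_mx z i j : R[i]) *: b (phi (delta_mx 0 i)) (phi' (delta_mx 0 j)).
have Psi_linear : linear Psi.
  move=> a s t; rewrite /Psi scaler_sumr -big_split; apply: eq_bigr => i _.
  rewrite scaler_sumr -big_split; apply: eq_bigr => j _ /=.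
  by rewrite linearP !mxE scalerDl scalerA.
exists (HB.pack_for {linear 'rV[K]_(d * d') -> Z} Psi
  (GRing.isLinear.Build _ _ _ _ Psi Psi_linear)).
move=> s t; rewrite /= /Psi mxvecK {1}[s]row_sum_delta linear_sum linear_sumlz.
apply: eq_bigr => i _.
rewrite {1}[t]row_sum_delta linear_sum linear_sumr; apply: eq_bigr => j _.
rewrite !linearZ /= linearZl_LR /= scalerA mulrC; congr (_ *: _).
by rewrite !mxE big_ord1 !mxE.
Qed.

Lemma fd_cvg_bilinear (U W Z : lmodType R[i]) (b : {bilinear U -> W -> Z})
    u lu w lw :
  fd_cvg u lu -> fd_cvg w lw -> fd_cvg (fun k => b (u k) (w k)) (b lu lw).
Proof.
move=> [d [phi [x [y [_ ux -> xy]]]]] [d' [phi' [x' [y' [_ wx' -> xy']]]]].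
have [Psi bPsi] := bilinear_tensor b phi phi'.
rewrite bPsi (_ : (fun _ => _) = Psi \o (fun k => mxvec ((x k)^T *m x' k))); last first.
  by apply/funext => k /=; rewrite ux wx' bPsi.
apply: fd_cvg_image; apply/cvg_mx => i j; case/mxvec_indexP: j => j1 j2.
rewrite ord1 mxvec_tensorE; under eq_fun do rewrite mxvec_tensorE.
by apply: cvgM; [exact: ((cvg_mx x y).2 xy)|exact: ((cvg_mx x' y').2 xy')].
Qed.

Lemma fd_cvg_linear (V W : lmodType R[i]) (f : {linear V -> W}) v l :
  fd_cvg v l -> fd_cvg (f \o v) (f l).
Proof.
move=> [d [phi [x [y [_ vx -> xy]]]]].
rewrite (_ : f \o v = (f \o phi) \o x); first exact: (@fd_cvg_image _ _ (f \o phi)).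
by apply/funext => k /=; rewrite vx.
Qed.

(** The two sequences may live in different subspaces. Their joint parametrisation by K^(d + d') may
    fail to be injective, which [fd_cvg_image] allows. *)
Lemma fd_cvg_lincomb (V : lmodType R[i]) (a : R[i]) (v : nat -> V) l w m :
  fd_cvg v l -> fd_cvg w m -> fd_cvg (fun k => a *: v k + w k) (a *: l + m).
Proof.
move=> [d [phi [x [y [_ vx -> xy]]]]] [d' [phi' [x' [y' [_ wx' -> xy']]]]].
pose psi : {linear 'rV[K]_(d + d') -> V} :=
  (a \*: (phi \o lsubmx)) \+ (phi' \o rsubmx).
have -> : a *: phi y + phi' y' = psi (row_mx y y') by rewrite /= row_mxKl row_mxKr.
rewrite (_ : (fun _ => _) = psi \o (fun k => row_mx (x k) (x' k))); last first.
  by apply/funext => k /=; rewrite vx wx' row_mxKl row_mxKr.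
apply: fd_cvg_image; apply/cvg_mx => i j; rewrite mxE.
under eq_fun do rewrite mxE.
by case: (fintype.split j) => c; [exact: ((cvg_mx x y).2 xy)|exact: ((cvg_mx x' y').2 xy')].
Qed.

(** The zero sequence - v + v tends to m - l; in injective coordinates it is 0, hence so is its
    limit, K^d being Hausdorff. *)
Lemma fd_cvg_unique (V : lmodType R[i]) (v : nat -> V) l m :
  fd_cvg v l -> fd_cvg v m -> l = m.
Proof.
move=> vl vm; have [d [phi [x [y [phi_inj vx ey xy]]]]] := fd_cvg_lincomb (-1) vl vm.
have x0 : x = cst 0.
  by apply/funext => k; apply: phi_inj; rewrite -vx linear0 scaleN1r addNr.
have y0 : y = 0.
  rewrite -(cvg_lim _ xy); last exact: norm_hausdorff.
  by rewrite x0 lim_cst //; exact: norm_hausdorff.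
by move: ey; rewrite y0 linear0 scaleN1r addrC => /eqP; rewrite subr_eq0 => /eqP.
Qed.

End FiniteDimensionalConvergence.

(** * Exponentials of locally finite operators *)

Section OperatorExponential.
Variables (R : realType).
Local Notation K := (R[i]^o).

(* [psi] parametrises an [A]-stable finite-dimensional subspace containing [v];
   it is not required to be injective. *)
Definition finite_orbit (V : lmodType R[i]) (A : V -> V) (v : V) : Prop :=
  exists d (psi : {linear 'rV[K]_d -> V}) (M : 'M[K]_d) (x : 'rV[K]_d),
    v = psi x /\ forall z, A (psi z) = psi (z *m M).

Lemma exp_sum_intertwine (V W : lmodType R[i]) (f : {linear V -> W}) A B v N :
  (forall w, f (A w) = B (f w)) -> f (exp_sum A v N) = exp_sum B (f v) N.
Proof.
move=> fAB; rewrite linear_sum; apply: eq_bigr => k _; rewrite linearZ /=.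
by congr (_ *: _); elim: (nat_of_ord k) => //= n <-.
Qed.

Lemma iter_mulmx_bound d (M : 'M[K]_d) (x : 'rV[K]_d) :
  exists c b : R, [/\ 0 <= c, 0 <= b &
    forall k j, `|iter k (mulmxr M) x 0 j : R[i]| <= (c * b ^+ k)%:C].
Proof.
(* The constants are the sums of the norms of all entries of x and of M; [complex.Re] brings these
   norms from [R[i]] back to R. *)
pose c := \sum_j complex.Re (`|x 0 j| : R[i]).
pose b := \sum_i \sum_j complex.Re (`|M i j| : R[i]).
have Re_norm (z : R[i]) : (complex.Re `|z|)%:C = `|z| by rewrite RRe_real // normr_real.
have Re_ge0 (z : R[i]) : 0 <= complex.Re `|z| by rewrite -ler0c Re_norm.
have bE : b%:C = \sum_i \sum_j `|M i j : R[i]|.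
  rewrite rmorph_sum; apply: eq_bigr => i _.
  by rewrite rmorph_sum; apply: eq_bigr => j _; exact: Re_norm.
have cE : c%:C = \sum_j `|x 0 j : R[i]|.
  by rewrite rmorph_sum; apply: eq_bigr => j _; exact: Re_norm.
exists c, b; split; first by apply: sumr_ge0.
  by apply: sumr_ge0 => i _; apply: sumr_ge0.
elim=> [|k IH] j.
  by rewrite /= mulr1 cE (bigD1 j) //= lerDl sumr_ge0.
rewrite iterS /= mxE (le_trans (ler_norm_sum _ _ _)) //.
rewrite exprSr mulrA rmorphM /= bE mulr_sumr.
apply: ler_sum => i _; rewrite normrM ler_pM //.
by rewrite (bigD1 j) //= lerDl sumr_ge0.
Qed.

Lemma is_cvg_exp_sum_mulmx d (M : 'M[K]_d) (x : 'rV[K]_d) :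
  exists y : 'rV[K]_d, exp_sum (mulmxr M) x @ \oo --> y.
Proof.
have [c [b [_ b0 bound]]] := iter_mulmx_bound M x.
have /choice[y hy] j := is_cvg_expC_dominated b0 (bound^~ j).
exists (\row_j y j); apply/cvg_mx => i j; rewrite ord1 mxE.
rewrite (_ : (fun _ => _) =
  (fun N => \sum_(k < N) (k`!%:R)^-1 * (iter k (mulmxr M) x 0 j) : K)).
  exact: hy.
by apply/funext => N; rewrite /exp_sum summxE; apply: eq_bigr => k _; rewrite mxE.
Qed.

Lemma fd_cvg_exp_sum (V : lmodType R[i]) (A : V -> V) v :
  finite_orbit A v -> fd_cvg (exp_sum A v) (op_exp A v).
Proof.
move=> [d [psi [M [x [-> AM]]]]]; rewrite /op_exp.
have [y xy] := is_cvg_exp_sum_mulmx M x.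
(* A limit exists, so [xget] returns a limit and not its default. *)
apply: xgetPex.
exists (psi y); have := fd_cvg_image psi xy; rewrite (_ : psi \o _ = exp_sum A (psi x)) //.
by apply/funext => N; apply: exp_sum_intertwine => z /=; rewrite AM.
Qed.

Lemma op_expE (V : lmodType R[i]) (A : V -> V) v l :
  fd_cvg (exp_sum A v) l -> op_exp A v = l.
Proof.
move=> vl; apply: fd_cvg_unique (vl).
exact: (@xgetPex _ 0 (fun l => fd_cvg (exp_sum A v) l) (ex_intro _ l vl)).
Qed.

Lemma op_exp_id (V : lmodType R[i]) (A : V -> V) v :
  A 0 = 0 -> A v = 0 -> op_exp A v = v.
Proof.
move=> A0 Av; apply: op_expE.
pose psi (z : 'rV[K]_1) := (z 0 0 : R[i]) *: v.
have psi_linear : linear psi by move=> a s t; rewrite /psi !mxE scalerDl scalerA.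
pose psiL : {linear 'rV[K]_1 -> V} :=
  HB.pack psi (GRing.isLinear.Build _ _ _ _ psi psi_linear).
(* The partial sum is 0 at N = 0 and v from N = 1 on. *)
have -> : exp_sum A v = psiL \o (fun N => const_mx (0 < N)%N%:R).
  apply/funext => -[|N]; rewrite /exp_sum /= /psi mxE ?big_ord0 ?scale0r //.
  rewrite big_ord_recl /= invr1 !scale1r big1 ?addr0 // => k _.
  suff -> : A (iter k A v) = 0 by rewrite scaler0.
  by elim: (nat_of_ord k) => //= n ->.
rewrite [X in fd_cvg _ X](_ : v = psiL (const_mx 1)); last by rewrite /= /psi mxE scale1r.
apply: fd_cvg_image; apply/cvg_mx => i j; rewrite mxE.
under eq_fun do rewrite mxE.
by apply: cvg_near_cst; exists 1%N => // -[].
Qed.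

Lemma op_exp_linear (V : lmodType R[i]) (A : {linear V -> V}) :
  (forall v, finite_orbit A v) -> linear (op_exp A).
Proof.
move=> Afin a v w; apply: op_expE.
rewrite (_ : exp_sum A _ = (fun N => a *: exp_sum A v N + exp_sum A w N)).
  by apply: fd_cvg_lincomb; exact: fd_cvg_exp_sum.
apply/funext => N; rewrite /exp_sum scaler_sumr -big_split; apply: eq_bigr => k _ /=.
rewrite scalerA mulrC -scalerA -scalerDr; congr (_ *: _).
by elim: (nat_of_ord k) => //= n ->; rewrite linearP.
Qed.

(** Linear maps preserve these limits. Taking L(0) for [f] will give preservation of weights; other
    choices carry matrix exponentials into V. *)
Lemma op_exp_intertwine (V W : lmodType R[i]) (f : {linear V -> W}) A B v :
  finite_orbit A v -> (forall w, f (A w) = B (f w)) ->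
  op_exp B (f v) = f (op_exp A v).
Proof.
move=> Av fAB; apply: op_expE.
have := fd_cvg_linear f (fd_cvg_exp_sum Av).
rewrite (_ : f \o _ = exp_sum B (f v)) //.
by apply/funext => N; exact: exp_sum_intertwine.
Qed.

(** The product of the truncated series of [A] and [B] differs from that of [C] by a corner sum
    whose tensor coordinates tend to 0. *)
Lemma op_exp_Leibniz (U W Z : lmodType R[i]) (b : {bilinear U -> W -> Z})
    (A : U -> U) (B : W -> W) (C : {linear Z -> Z}) u w :
  (forall u w, C (b u w) = b (A u) w + b u (B w)) ->
  finite_orbit A u -> finite_orbit B w ->
  op_exp C (b u w) = b (op_exp A u) (op_exp B w).
Proof.
move=> Leib Au Bw; apply: op_expE.
pose tail N := \sum_(0 <= i < N) \sum_(N - i <= j < N)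
    ((i`!%:R : R[i])^-1 * (j`!%:R)^-1) *: b (iter i A u) (iter j B w).
suff tail0 : fd_cvg tail 0.
  have := fd_cvg_lincomb (-1) tail0
    (fd_cvg_bilinear b (fd_cvg_exp_sum Au) (fd_cvg_exp_sum Bw)).
  rewrite scaler0 add0r (_ : (fun _ => _) = exp_sum C (b u w)) //.
  apply/funext => N; rewrite (exp_sum_Leibniz Leib) scaleN1r addrC.
  by rewrite -/(tail N) addrK.
case: Au => d [psi [M [x [ux AM]]]]; case: Bw => d' [psi' [M' [x' [wx' BM']]]].
have [c1 [b1 [c1_ge0 b1_ge0 bound1]]] := iter_mulmx_bound M x.
have [c2 [b2 [c2_ge0 b2_ge0 bound2]]] := iter_mulmx_bound M' x'.
have [Psi bPsi] := bilinear_tensor b psi psi'.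
have iterE (V : lmodType R[i]) n (f : {linear 'rV[K]_n -> V}) N F k z :
    (forall t, F (f t) = f (t *m N)) -> iter k F (f z) = f (iter k (mulmxr N) z).
  by move=> FN; elim: k => //= k ->.
pose z i j := mxvec ((iter i (mulmxr M) x)^T *m iter j (mulmxr M') x').
rewrite (_ : tail = Psi \o (fun N => \sum_(0 <= i < N) \sum_(N - i <= j < N)
    ((i`!%:R : K)^-1 * (j`!%:R)^-1) *: z i j)); last first.
  apply/funext => N /=; rewrite /tail linear_sum; apply: eq_bigr => i _.
  rewrite linear_sum; apply: eq_bigr => j _.
  by rewrite ux wx' (iterE _ _ _ M) // (iterE _ _ _ M') // bPsi linearZ.
rewrite -(linear0 Psi); apply: fd_cvg_image; apply/cvg_mx => l m.
case/mxvec_indexP: m => m1 m2; rewrite ord1 mxE.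
rewrite (_ : (fun _ => _) = (fun N => \sum_(0 <= i < N) \sum_(N - i <= j < N)
    ((i`!%:R)^-1 * (j`!%:R)^-1) * (z i j 0 (mxvec_index m1 m2) : R[i]) : K)).
  (* As b1 and b2 are at most b1 + b2, the coordinates are bounded by c1 c2 (b1 + b2)^(i + j). *)
  apply: (@cvg_exp_tail _ _ (c1 * c2) (b1 + b2)) => i j.
  rewrite mxvec_tensorE normrM (le_trans (ler_pM _ _ (bound1 i m1) (bound2 j m2))) //.
  rewrite -rmorphM lecR exprD mulrACA ler_wpM2l ?mulr_ge0 //.
  by rewrite ler_pM ?exprn_ge0 // lerXn2r ?nnegrE ?addr_ge0 ?lerDl ?lerDr.
apply/funext => N; rewrite summxE; apply: eq_bigr => i _.
by rewrite summxE; apply: eq_bigr => j _; rewrite mxE.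
Qed.

End OperatorExponential.

(** * Inverse of an exponential, and construction of finite orbits *)

Section OperatorExponentialInverse.
Variables (R : realType).
Local Notation K := (R[i]^o).

(* The product E'E of the matrices of exp(-M) and exp(M) is computed by applying the
   Leibniz rule to the matrix product, right multiplication by -M on the left factor
   and left multiplication by M on the right factor adding up to 0. *)
Lemma op_expNK (V : lmodType R[i]) (A B : V -> V) v :
  (forall w, B w = - A w) -> finite_orbit A v -> op_exp A (op_exp B v) = v.
Proof.
move=> BA [d [psi [M [x [-> AM]]]]].
have BM z : B (psi z) = psi (z *m - M) by rewrite BA AM mulmxN linearN.
have mx_orbit (f : {linear 'M[K]_d -> 'M[K]_d}) Q : finite_orbit f Q.
  exists (d * d)%N, vec_mx, (lin_mx f), (mxvec Q).
  by split=> [|z] /=; rewrite ?mxvecK ?mx_rV_lin.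
(* On the image of [psi] the exponential is right multiplication by a matrix exponential, itself the
   value at the identity of an operator exponential. *)
have op_exp_psi (F : V -> V) N z : (forall t, F (psi t) = psi (t *m N)) ->
    op_exp F (psi z) = psi (z *m op_exp (mulmxr N) 1%:M).
  move=> FN; rewrite -{1}(mulmx1 z).
  pose f : {linear 'M[K]_d -> V} := psi \o mulmx z.
  rewrite -[psi _]/(f 1%:M) (@op_exp_intertwine _ _ _ f (mulmxr N)) // => Q.
  by rewrite /f /= FN mulmxA.
rewrite (op_exp_psi B (- M)) // (op_exp_psi A M) // -mulmxA.
(* Powers of M commute with M, so left and right multiplication have the same exponential at the
   identity. *)
have <- : op_exp (mulmx M) 1%:M = op_exp (mulmxr M) 1%:M.
  apply: op_expE; have := fd_cvg_exp_sum (mx_orbit (mulmxr M) 1%:M).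
  rewrite (_ : exp_sum (mulmx M) _ = exp_sum (mulmxr M) 1%:M) //.
  apply/funext => N; apply: eq_bigr => k _; congr (_ *: _).
  have comm n : iter n (mulmxr M) 1%:M *m M = M *m iter n (mulmxr M) 1%:M.
    by elim: n => [|n IH] /=; rewrite ?mul1mx ?mulmx1 // {1}IH mulmxA.
  by elim: (nat_of_ord k) => //= n ->; rewrite comm.
rewrite -(@op_exp_Leibniz _ _ _ _ mulmx _ _ \0) //.
- rewrite op_exp_id //; congr (psi _).
  by transitivity (x *m 1%:M); [congr (_ *m _); exact: mulmx1|exact: mulmx1].
- by move=> P Q; rewrite /= mulmxN mulNmx mulmxA addNr.
- exact: (mx_orbit (mulmx M)).
Qed.

Lemma finite_orbit0 (V : lmodType R[i]) (A : {linear V -> V}) : finite_orbit A 0.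
Proof.
by exists 0%N, \0, 0, 0; split=> // z; exact: linear0.
Qed.

Lemma finite_orbitD (V : lmodType R[i]) (A : {linear V -> V}) v w :
  finite_orbit A v -> finite_orbit A w -> finite_orbit A (v + w).
Proof.
move=> [d [psi [M [x [-> AM]]]]] [d' [psi' [M' [x' [-> AM']]]]].
exists (d + d')%N, ((psi \o lsubmx) \+ (psi' \o rsubmx)),
  (block_mx M 0 0 M'), (row_mx x x').
split=> [|z] /=; first by rewrite row_mxKl row_mxKr.
rewrite linearD AM AM' -{3 4}[z]hsubmxK mul_row_block !mulmx0 addr0 add0r.
by rewrite row_mxKl row_mxKr.
Qed.

Lemma finite_orbit_stable (V : lmodType R[i]) (A : {linear V -> V}) (W : set V) v :
  fin_dim W -> (forall w, W w -> W (A w)) -> W v -> finite_orbit A v.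
Proof.
move=> [d [e ->]] WA [c _ <-].
(* The [e j] span W but may be dependent: M is one choice of coefficients. *)
have /choice[M AM] j : exists m : 'I_d -> R[i], A (e j) = \sum_(i < d) m i *: e i.
  have [|m _ <-] := WA (e j); last by exists m.
  exists (fun i => (i == j)%:R) => //; rewrite (bigD1 j) //= eqxx scale1r.
  by rewrite big1 ?addr0 // => i /negPf ->; rewrite scale0r.
pose psi (z : 'rV[K]_d) := \sum_(i < d) (z 0 i : R[i]) *: e i.
have psi_linear : linear psi.
  move=> a s t; rewrite /psi scaler_sumr -big_split; apply: eq_bigr => i _ /=.
  by rewrite !mxE scalerDl scalerA.
exists d, (HB.pack_for {linear 'rV[K]_d -> V} psi
  (GRing.isLinear.Build _ _ _ _ psi psi_linear)).
exists (\matrix_(i, j) M i j), (\row_i c i); split=> [|z] /=.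
  by apply: eq_bigr => i _; rewrite mxE.
rewrite linear_sum /psi.
under [RHS]eq_bigr do rewrite mxE scaler_suml.
rewrite exchange_big /=; apply: eq_bigr => j _.
rewrite linearZ /= AM scaler_sumr; apply: eq_bigr => i _.
by rewrite mxE scalerA.
Qed.

End OperatorExponentialInverse.

(** * Modes of a vertex operator algebra *)

Section VertexOperatorAlgebra.
Variables (R : realType) (V : voa R).
Local Notation Y := (@voa_Y R V).
Local Notation omega := (voa_omega V).

HB.instance Definition _ n := bilinear_isBilinear.Build R[i] V V V *:%R *:%R (Y n)
  (voa_Y_linearl n, voa_Y_linear n).

Lemma binz0 (F : fieldType) m : binz F m 0 = 1.
Proof. by rewrite /binz big_ord0 divr1. Qed.

Lemma binz1 (F : fieldType) m : binz F m 1 = m%:~R.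
Proof. by rewrite /binz big_ord_recl big_ord0 subr0 mulr1 divr1. Qed.

Lemma binz_small (F : fieldType) (m i : nat) : (m < i)%N -> binz F m i = 0.
Proof.
move=> mi; rewrite /binz (bigD1 (Ordinal mi)) //=.
by rewrite -pmulrn subrr !mul0r.
Qed.

Lemma fsum_nat_ord (W : zmodType) (F : nat -> W) k :
  (forall i, (k <= i)%N -> F i = 0) -> \sum_(i \in [set: nat]) F i = \sum_(i < k) F i.
Proof.
move=> F0; rewrite fsbig_ord; apply/esym/fsbig_widen => // i [_ /= /negP].
by rewrite -leqNgt => /F0.
Qed.

(** Borcherds' commutator formula: the Jacobi identity at l = 0, where binom(0, i) leaves only i = 0
    on the left. *)
Lemma voa_commutator k m n u v w :
  (forall i, (k <= i)%N -> binz R[i] m i *: Y (m + n - i%:Z) (Y i u v) w = 0) ->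
  Y m u (Y n v w) - Y n v (Y m u w) =
  \sum_(i < k) binz R[i] m i *: Y (m + n - i%:Z) (Y i u v) w.
Proof.
move=> vanish; have := voa_jacobi 0 m n u v w.
have bin00 i : (1 <= i)%N -> binz R[i] 0 i = 0 by exact: (@binz_small _ 0).
rewrite (@fsum_nat_ord _ _ 1); last by move=> i /bin00 ->; rewrite mulr0 scale0r.
rewrite (@fsum_nat_ord _ _ 1); last by move=> i /bin00 ->; rewrite mulr0 scale0r.
rewrite !big_ord1 binz0 expr0 expr0z !mulr1 !scale1r.
rewrite /= !addr0 => ->.
rewrite (@fsum_nat_ord _ _ k) => [|i ki]; last by rewrite add0r vanish.
by apply: eq_bigr => i _; rewrite add0r.
Qed.

Lemma zero_mode_derivation u n v w :
  Y 0 u (Y n v w) = Y n (Y 0 u v) w + Y n v (Y 0 u w).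
Proof.
have := @voa_commutator 1 0 n u v w.
rewrite big_ord1 binz0 scale1r add0r subr0 => <-; first by rewrite addrNK.
by move=> i i0; rewrite (@binz_small _ 0) // scale0r.
Qed.

Lemma L0_mode1 v n : voa_gr V n v -> Y 1 omega v = n%:~R *: v.
Proof. by move=> /voa_L0; rewrite add0r. Qed.

Lemma mode_Lm1 n v w : Y n (Y 0 omega v) w = (- n)%:~R *: Y (n - 1) v w.
Proof. by rewrite -voa_Lm1 addNr. Qed.

Lemma voa_gr_submod n a v w : voa_gr V n v -> voa_gr V n w -> voa_gr V n (a *: v + w).
Proof.
have [d [e ->]] := voa_gr_fin_dim V n; move=> [c _ <-] [c' _ <-].
exists (fun i => a * c i + c' i) => //; rewrite scaler_sumr -big_split.
by apply: eq_bigr => i _; rewrite scalerDl scalerA.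
Qed.

Lemma voa_gr0 n : voa_gr V n 0.
Proof.
have [d [e ->]] := voa_gr_fin_dim V n.
by exists (fun=> 0) => //; rewrite big1 // => i _; rewrite scale0r.
Qed.

Lemma voa_grZ n a v : voa_gr V n v -> voa_gr V n (a *: v).
Proof. by move=> vn; rewrite -[_ *: _]addr0; exact: voa_gr_submod vn (voa_gr0 n). Qed.

Lemma fsum_support (w f : int -> V) : finite_set [set n | w n != 0] ->
  (forall n, w n = 0 -> f n = 0) ->
  \sum_(n \in [set: int]) f n = \sum_(n <- fset_set [set n | w n != 0]) f n.
Proof.
move=> wfin fw; apply: fsbigTE => n; rewrite in_fset_set // notin_setE /=.
by move=> /negP; rewrite negbK => /eqP/fw.
Qed.

(** If v has components w_k, then L(0)v has components n w_k and also k w_k; uniqueness gives (k -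
    n) w_k = 0, so only w_n survives. *)
Lemma gr_of_L0_eigen n v : Y 1 omega v = n%:~R *: v -> voa_gr V n v.
Proof.
have [w [[wgr wfin ->] _]] := voa_gr_sum v; set v' := \sum_(_ \in _) _ => eigen.
have support_sub (c : int -> R[i]) : finite_set [set k | c k *: w k != 0].
  by apply: sub_finite_set wfin => k /=; apply: contra_neq => ->; rewrite scaler0.
have [z [_ z_unique]] := voa_gr_sum (n%:~R *: v').
have zn : z = fun k => n%:~R *: w k.
  apply: z_unique; split=> [k||]; [exact: voa_grZ|exact: (support_sub (fun=> _))|].
  rewrite /v' !(fsum_support (w := w)) // => [|k ->]; last exact: scaler0.
  by rewrite scaler_sumr.
have zk : z = fun k => k%:~R *: w k.
  apply: z_unique; split=> [k||]; [exact: voa_grZ|exact: (support_sub intr)|].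
  rewrite -eigen /v' !(fsum_support (w := w)) // => [|k ->]; last exact: scaler0.
  by rewrite linear_sumr; apply: eq_bigr => k _; exact: L0_mode1.
have w0 k : k != n -> w k = 0.
  move=> kn; have /eqP := congr1 (@^~ k) (etrans (esym zk) zn).
  rewrite -subr_eq0 -scalerBl -rmorphB scaler_eq0 intr_eq0 subr_eq0 (negPf kn).
  by move/eqP.
rewrite /v' -(@fsbig_widen _ _ _ _ [set n]) ?fsbig_set1 // => k [_ /= /eqP].
exact: w0.
Qed.

Lemma finite_orbit_gr (A : {linear V -> V}) v :
  (forall n w, voa_gr V n w -> voa_gr V n (A w)) -> finite_orbit A v.
Proof.
move=> Agr; have [w [[wgr wfin ->] _]] := voa_gr_sum v.
rewrite (fsum_support wfin) //.
apply: (big_ind (finite_orbit A)) => [|*|n _]; first exact: finite_orbit0.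
  exact: finite_orbitD.
exact: finite_orbit_stable (voa_gr_fin_dim V n) (Agr n) (wgr n).
Qed.

End VertexOperatorAlgebra.

(** * The zero mode of a weight-one vector killed by L(1) *)

Section WeightOneExponential.
Variables (R : realType) (V : voa R).
Hypothesis gr_neg : forall n : int, n < 0 -> voa_gr V n = [set 0].
Variable u : V.
Hypotheses (u_gr : voa_gr V 1 u) (L1u : voa_L 1 u = 0).
Local Notation Y := (@voa_Y R V).
Local Notation omega := (voa_omega V).

(** [L(0), Y_0(u)] = Y_1(L(-1)u) + Y_0(L(0)u), whose terms are -Y_0(u) and Y_0(u). *)
Lemma L0_zero_mode v : Y 1 omega (Y 0 u v) = Y 0 u (Y 1 omega v).
Proof.
apply/eqP; rewrite -subr_eq0 (@voa_commutator _ _ 2); last first.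
  by move=> i i2; rewrite (@binz_small _ 1) ?scale0r.
rewrite big_ord_recl big_ord1 /= binz0 binz1 mode_Lm1 (L0_mode1 u_gr).
by rewrite scale1r !addr0 scale1r subrr scaleN1r scale1r addNr.
Qed.

Lemma zero_mode_gr n v : voa_gr V n v -> voa_gr V n (Y 0 u v).
Proof.
by move=> /L0_mode1 vn; apply: gr_of_L0_eigen; rewrite L0_zero_mode vn linearZr_LR.
Qed.

(* [Y i omega u] is L(i-1)u, which lies in V_(2-i). *)
Lemma omega_mode_u i : (2 <= i)%N -> Y i omega u = 0.
Proof.
(* Mode 2 gives L(1)u = 0; what remains is mode i + 3, that is L(i+2)u. *)
case: i => [|[|[|i]]] // _.
have [c /(_ 0 (i.+2) u) /=] := voa_virasoro V.
have i3 : i.+2%:Z + 1 = i.+3 by rewrite -PoszD addn1.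
rewrite !add0r addr0 i3 (L0_mode1 u_gr) scale1r => vir.
(* The Virasoro relation gives L(0)L(i+2)u = (1 - (i+2)) L(i+2)u, a negative weight. *)
suff : voa_gr V (- i.+1%:Z) (Y i.+3 omega u) by rewrite gr_neg.
apply: gr_of_L0_eigen; rewrite -(subrK (Y i.+3 omega u) (Y 1 omega _)) vir.
rewrite -[X in _ + X]scale1r -scalerDl -[1]/(1%:~R) -rmorphD.
by rewrite -addn1 PoszD opprD addrNK.
Qed.

(* omega = L(-2)1 and [Y_0(u), L(-2)] = 0, as L(k)u = 0 for k >= 1. *)
Lemma zero_mode_omega : Y 0 u omega = 0.
Proof.
(* On the vacuum, the term i = 0 is Y_(-2)(u)1 and the term i = 1 is its opposite, as binom(-1, 1) =
   -1. *)
have := @voa_commutator _ V 2 (-1) 0 omega u (voa_vac V).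
rewrite big_ord_recl big_ord1 /= binz0 binz1 mode_Lm1 (L0_mode1 u_gr).
rewrite (voa_creation u (n := 0)) // linear0r sub0r voa_creation_lim.
move=> comm; apply/eqP; rewrite -oppr_eq0 comm => [|i i2]; last first.
  by rewrite omega_mode_u // linear0l scaler0.
rewrite (_ : - (-1 + 0 - 0%:Z) = 1) // !scale1r.
by rewrite (_ : -1 + 0 - 0%:Z - 1 = -1 + 0 - (bump 0 0)%:Z) // scaleN1r subrr.
Qed.

Fact scaled_zero_mode_linear (t : R[i]) : linear (fun v : V => t *: Y 0 u v).
Proof. by move=> a v w; rewrite linearPr scalerDr scalerA mulrC -scalerA. Qed.

Definition scaled_zero_mode (t : R[i]) : {linear V -> V} :=
  HB.pack (fun v : V => t *: Y 0 u v)
    (GRing.isLinear.Build R[i] V V *:%R _ (scaled_zero_mode_linear t)).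

Lemma scaled_zero_mode_orbit t v : finite_orbit (scaled_zero_mode t) v.
Proof. by apply: finite_orbit_gr => n w wn; exact/voa_grZ/zero_mode_gr. Qed.

End WeightOneExponential.

(** * Verification of the automorphism axioms *)

Theorem proposition5p1 (R : realType) (V : voa R)
  (hV0 : voa_gr V 0 = [set c *: voa_vac V | c in [set: R[i]]])
  (hVneg : forall n : int, n < 0 -> voa_gr V n = [set 0])
  (u : V) (hu1 : voa_gr V 1 u) (hLu : voa_L 1 u = 0) (t : R[i]) :
  voa_automorphism (op_exp (fun v : V => t *: voa_Y 0 u v)).
Proof.
pose A := scaled_zero_mode u.
have orbit s v : finite_orbit (A s) v by exact: scaled_zero_mode_orbit.
have expK s v : op_exp (A s) (op_exp (A (- s)) v) = v.
  by apply: op_expNK => // w; rewrite /= scaleNr.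
have exp_id v : A t v = 0 -> op_exp (A t) v = v.
  by apply: op_exp_id; exact: linear0.
rewrite -[X in op_exp X]/(A t : V -> V).
have exp_linear : linear (op_exp (A t)) by exact: op_exp_linear.
split.
- split=> //.
  by exists (op_exp (A (- t))) => v; rewrite ?expK // -{2}(opprK t) expK.
- move=> n v vn.
  (* L(0) commutes with [A t], hence with its exponential, so the image of v is still an
     L(0)-eigenvector for n and thus has weight n. *)
  pose L0 : {linear V -> V} := HB.pack (voa_Y 1 (voa_omega V))
    (GRing.isLinear.Build R[i] V V *:%R _ (voa_Y_linear 1 (voa_omega V))).
  have AL0 w : L0 (A t w) = A t (L0 w) by rewrite /= linearZr_LR /= L0_zero_mode.
  apply: gr_of_L0_eigen; rewrite -[LHS]/(L0 _) -(op_exp_intertwine (orbit t v) AL0).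
  by rewrite /= (L0_mode1 vn) (scalable_linear exp_linear).
- move=> n v w; apply: (@op_exp_Leibniz _ _ _ _ (voa_Y n)) => // {}v {}w.
  by rewrite /= zero_mode_derivation scalerDr linearZl_LR linearZr_LR.
- by apply: exp_id; rewrite /= voa_creation // scaler0.
- by apply: exp_id; rewrite /= zero_mode_omega // scaler0.
Qed.
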